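(* Let $\hbar\ne0$ be real. For kernels $k_1,k_2$ on $\mathbb{R}^{4n}$ the composition $\mathsf{D}(k_1)\mathsf{D}(k_2)$ of two-sided relative convolutions is the two-sided relative convolution $\mathsf{D}(k)$ with the kernel $$k=\big((k_1\circ B)\mathbin{\natural}(k_2\circ B)\big)\circ B^{-1},$$ where $\natural$ is the twisted convolution on $\mathbb{R}^{4n}$. Explicitly, $$k(x_1',y_1',x_2',y_2')=\int_{\mathbb{R}^{4n}}k_1(x_1,y_1,x_2,y_2)\,k_2(x_1'-x_1,y_1'-y_1,x_2'-x_2,y_2'-y_2)\,e^{\pi i\hbar(x_1y_1'-y_1x_1'+y_2x_2'-x_2y_2')}\,dx_1\,dx_2\,dy_1\,dy_2.$$
   Context: Products of vectors in $\mathbb{R}^n$ are dot products; all variables $x_1,y_1,x_2,y_2$ (and primed) are in $\mathbb{R}^n$. Pulled actions on functions on $\mathbb{R}^{2n}$: $[\Lambda_\hbar(s,x,y)f](x',y')=e^{\pi i\hbar(2s+xy'-yx')}f(x'-x,y'-y)$ and $[R_\hbar(s,x,y)f](x',y')=e^{\pi i\hbar(-2s+xy'-yx')}f(x'+x,y'+y)$. Two-sided relative convolution: $\mathsf{D}(k)=\int_{\mathbb{R}^{4n}}k(x_1,y_1,x_2,y_2)\,\Lambda_\hbar(0,x_1,y_1)R_\hbar(0,x_2,y_2)\,dx_1dy_1dx_2dy_2$, which is a bounded operator on $L_2(\mathbb{R}^{2n})$ for $k\in L_1(\mathbb{R}^{4n})$. For a fixed real $\upsilon\neq0$ let $B:\mathbb{R}^{4n}\to\mathbb{R}^{4n}$,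 $B(x_1,x_2,y_1,y_2)=(x_1,y_1,\upsilon y_2,x_2/\upsilon)$. Twisted convolution on $\mathbb{R}^{2N}$: $(f_1\mathbin{\natural}f_2)(x,y)=\int_{\mathbb{R}^{2N}}f_1(x',y')f_2(x-x',y-y')e^{\pi i\hbar(x'y-y'x)}dx'dy'$; here $N=2n$, $x=(x_1,x_2)$, $y=(y_1,y_2)$. *)

(* Defs.v *)
From HB Require Import structures.
From mathcomp Require Import all_boot all_order all_algebra.
From mathcomp Require Import complex.
From mathcomp Require Import all_classical all_reals all_analysis.

Set Implicit Arguments.
Unset Strict Implicit.
Unset Printing Implicit Defensive.

Import Order.TTheory GRing.Theory Num.Theory.
Import numFieldNormedType.Exports.

Local Open Scope classical_set_scope.
Local Open Scope ring_scope.
Local Open Scope complex_scope.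

Definition measure_rV_display : measure_display -> measure_display.
Proof. exact. Qed.

(* Borel sigma-algebra of R^n, generated by the coordinate functions in the
   same way as the library's sigma-algebra on n.-tuple T. *)
Section measurable_rV.
Context {R : realType} {n : nat}.

Definition rV_coord (i : 'I_n) (v : 'rV[R]_n) : R := v ord0 i.

Let rV_set0 : g_sigma_preimage rV_coord set0.
Proof. exact: sigma_algebra0. Qed.

Let rV_setC A : g_sigma_preimage rV_coord A -> g_sigma_preimage rV_coord (~` A).
Proof. exact: sigma_algebraC. Qed.

Let rV_bigcup (F : _^nat) : (forall i, g_sigma_preimage rV_coord (F i)) ->
  g_sigma_preimage rV_coord (\bigcup_i (F i)).
Proof. exact: sigma_algebra_bigcup. Qed.

HB.instance Definition _ :=
  @isMeasurable.Build (measure_rV_display default_measure_display)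
    'rV[R]_n (g_sigma_preimage rV_coord) rV_set0 rV_setC rV_bigcup.

End measurable_rV.

Lemma measurable_rV_coord (R : realType) n (i : 'I_n) :
  measurable_fun [set: 'rV[R]_n] (rV_coord i).
Proof.
move=> _ Y mY; rewrite setTI; apply: sub_sigma_algebra => /=.
rewrite -bigcup_seq/=; exists i => /=; first by rewrite mem_index_enum.
by exists Y => //; rewrite setTI.
Qed.

Lemma measurable_fun_rVP d (T : measurableType d) (R : realType) n
    (f : T -> 'rV[R]_n) :
  measurable_fun [set: T] f <->
  forall i, measurable_fun [set: T] (fun x => f x ord0 i).
Proof.
apply: (@iff_trans _ (g_sigma_preimage
    (fun i => @rV_coord R n i \o f) `<=` measurable)).
  rewrite g_sigma_preimage_comp; split=> [mf A [/= C preC <-]|prefS].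
    exact: mf.
  by move=> _ A mA; apply: prefS; exists A.
split=> [fS i _ A mA|mf].
  apply: fS; apply: sub_sigma_algebra.
  rewrite -bigcup_seq/=; exists i => /=; first by rewrite mem_index_enum.
  by exists A.
apply: smallest_sub; first exact: sigma_algebra_measurable.
rewrite -bigcup_seq/=; apply: bigcup_sub => i _ A [B mB <-].
exact: mf.
Qed.

Section rV_cons.
Context {R : realType} {n : nat}.

Definition rV_cons (p : measurableTypeR R * 'rV[R]_n) : 'rV[R]_n.+1 :=
  @row_mx R 1 1 n (p.1 : R)%:M p.2.

Definition rV_uncons (v : 'rV[R]_n.+1) : measurableTypeR R * 'rV[R]_n :=
  (v ord0 ord0, @rsubmx R 1 1 n v).

Lemma rV_consK : cancel rV_cons rV_uncons.
Proof.
move=> [x v]; rewrite /rV_cons /rV_uncons/=; congr pair; last first.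
  exact: (@row_mxKr R 1 1 n).
have -> : (ord0 : 'I_n.+1) = @lshift 1 n ord0 by exact/val_inj.
by rewrite (@row_mxEl R 1 1 n) mxE eqxx mulr1n.
Qed.

Lemma measurable_rV_cons : measurable_fun setT rV_cons.
Proof.
apply/measurable_fun_rVP => i; rewrite /rV_cons.
case: (@split_ordP 1 n i) => j ->.
  rewrite (_ : (fun _ => _) = fst)//; apply/funext => p.
  by rewrite (@row_mxEl R 1 1 n) mxE (ord1 j) eqxx mulr1n.
rewrite (_ : (fun _ => _) = rV_coord j \o snd).
  by apply: measurableT_comp => //; exact: measurable_rV_coord.
by apply/funext => p; rewrite (@row_mxEr R 1 1 n).
Qed.

Lemma measurable_rV_uncons : measurable_fun setT rV_uncons.
Proof.
apply/measurable_fun_pairP; split; first exact: measurable_rV_coord.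
apply/measurable_fun_rVP => i.
rewrite (_ : (fun _ => _) = @rV_coord R n.+1 (@rshift 1 n i)).
  exact: measurable_rV_coord.
by apply/funext => v; rewrite /rV_uncons/= mxE.
Qed.

End rV_cons.

(* The library's sigma-finite structure on products is not canonical: it is
   shadowed by the one on products of subprobabilities.  Hence this named copy
   of the product measure. *)
Section sf_product.
Context d1 d2 (T1 : measurableType d1) (T2 : measurableType d2) (R : realType).
Variable m1 : {sigma_finite_measure set T1 -> \bar R}.
Variable m2 : {sigma_finite_measure set T2 -> \bar R}.

Definition sf_product : set (T1 * T2) -> \bar R := (m1 \x m2)%E.

HB.instance Definition _ := Measure.on sf_product.

Lemma sf_product_sigma_finite : sigma_finite setT sf_product.
Proof.
have /sigma_finiteP[F [TF ndF Foo]] := sigma_finiteT m1.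
have /sigma_finiteP[G [TG ndG Goo]] := sigma_finiteT m2.
exists (fun n => F n `*` G n).
  rewrite -setXTT TF TG predeqE => -[x y]; split.
    move=> [/= [n _ Fnx] [k _ Gky]]; exists (maxn n k) => //; split.
    - by move: x Fnx; exact/subsetPset/ndF/leq_maxl.
    - by move: y Gky; exact/subsetPset/ndG/leq_maxr.
  by move=> [n _ []/= ? ?]; split; exists n.
move=> k; have [? ?] := Foo k; have [? ?] := Goo k.
split; first exact: measurableX.
by rewrite /sf_product product_measure1E// lte_mul_pinfty// ge0_fin_numE.
Qed.

HB.instance Definition _ := Measure_isSigmaFinite.Build _ _ _ sf_product
  sf_product_sigma_finite.

End sf_product.

Section pushforward_sigma_finite.
Context d1 d2 (T1 : measurableType d1) (T2 : measurableType d2) (R : realType).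
Variables (mu : {sigma_finite_measure set T1 -> \bar R}).
Variables (f : T1 -> T2) (g : T2 -> T1).
Hypotheses (mg : measurable_fun setT g) (fK : cancel f g).

Lemma pushforward_sigma_finite : sigma_finite setT (pushforward mu f).
Proof.
have [F FT Foo] := sigma_finiteT mu.
exists (fun i => g @^-1` F i).
  by rewrite -preimage_bigcup -FT preimage_setT.
move=> i; have [mFi Fioo] := Foo i; split.
  by rewrite -[X in measurable X]setTI; exact: mg.
rewrite /pushforward -comp_preimage (_ : g \o f = id)//.
by apply/funext => x; exact: fK.
Qed.

End pushforward_sigma_finite.

Section lebesgue_rVS.
Context {R : realType} {n : nat}.
Variable mu : {sigma_finite_measure set 'rV[R]_n -> \bar R}.

Definition lebesgue_rVS : set 'rV[R]_n.+1 -> \bar R :=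
  pushforward (sf_product lebesgue_measure mu) rV_cons.

Let mcons : measurable_fun setT (@rV_cons R n).
Proof. exact: measurable_rV_cons. Qed.

Let lebesgue_rVS0 : lebesgue_rVS set0 = 0%E.
Proof. exact: measure0. Qed.

Let lebesgue_rVS_ge0 A : (0 <= lebesgue_rVS A)%E.
Proof. exact: measure_ge0. Qed.

Let lebesgue_rVS_sigma_additive : semi_sigma_additive lebesgue_rVS.
Proof. exact: measure_semi_sigma_additive. Qed.

HB.instance Definition _ := isMeasure.Build _ _ _ lebesgue_rVS
  lebesgue_rVS0 lebesgue_rVS_ge0 lebesgue_rVS_sigma_additive.

Let lebesgue_rVS_sigma_finite : sigma_finite setT lebesgue_rVS.
Proof.
apply: (@pushforward_sigma_finite _ _ _ _ R (sf_product _ _)).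
- exact: measurable_rV_uncons.
- exact: rV_consK.
Qed.

HB.instance Definition _ := Measure_isSigmaFinite.Build _ _ _ lebesgue_rVS
  lebesgue_rVS_sigma_finite.

End lebesgue_rVS.

(* Lebesgue measure on R^n, the n-fold product of Lebesgue measure on R:
   a point mass for n = 0, and otherwise the product of the measures on R and
   R^(n-1), transported along (x, v) |-> (x | v). *)
Fixpoint lebesgue_rV {R : realType} (n : nat) :
    {sigma_finite_measure set 'rV[R]_n -> \bar R} :=
  match n with
  | 0%N => \d_(0 : 'rV[R]_0)
  | m.+1 => lebesgue_rVS (lebesgue_rV m)
  end.

Definition lebesgue_2n {R : realType} (n : nat) :
    {sigma_finite_measure set ('rV[R]_n * 'rV[R]_n)%type -> \bar R} :=
  sf_product (lebesgue_rV n) (lebesgue_rV n).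

Definition lebesgue_4n {R : realType} (n : nat) :
    {sigma_finite_measure set
      (('rV[R]_n * 'rV[R]_n) * ('rV[R]_n * 'rV[R]_n))%type -> \bar R} :=
  sf_product (lebesgue_2n n) (lebesgue_2n n).

Section complex_functions.
Context {d : measure_display} {T : measurableType d} {R : realType}.
Variable mu : {measure set T -> \bar R}.

Definition Cintegral (f : T -> R[i]) : R[i] :=
  (\int[mu]_x complex.Re (f x)) +i* (\int[mu]_x complex.Im (f x)).

(* Genuine functions rather than classes modulo null sets. *)
Definition CLp (p : \bar R) (f : T -> R[i]) : Prop :=
  [/\ measurable_fun setT (fun x => complex.Re (f x)),
      measurable_fun setT (fun x => complex.Im (f x)) &
      finite_norm mu p (fun x => Normc.normc (f x))].

End complex_functions.

Section relative_convolution.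
Context {R : realType} {n : nat}.

Local Notation V := 'rV[R]_n.

Definition dot (x y : V) : R := \sum_(i < n) x ord0 i * y ord0 i.

(* Dot product of R^(2n), written as pairs of vectors of R^n. *)
Definition dot2 (x y : V * V) : R := dot x.1 y.1 + dot x.2 y.2.

Definition expi (t : R) : R[i] := cos t +i* sin t.

Variable hbar : R.

Definition Lambda (s : R) (x y : V) (f : V * V -> R[i]) : V * V -> R[i] :=
  fun z => expi (pi * hbar * (2 * s + dot x z.2 - dot y z.1)) *
           f (z.1 - x, z.2 - y).

Definition Rho (s : R) (x y : V) (f : V * V -> R[i]) : V * V -> R[i] :=
  fun z => expi (pi * hbar * (- 2 * s + dot x z.2 - dot y z.1)) *
           f (z.1 + x, z.2 + y).

(* Kernels take their arguments in the order ((x1, y1), (x2, y2)).  The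
   operator-valued integral is computed pointwise; for k in L1 and f in L2 it
   converges absolutely at almost every z. *)
Definition rconv (k : (V * V) * (V * V) -> R[i]) (f : V * V -> R[i]) :
    V * V -> R[i] :=
  fun z => Cintegral (lebesgue_4n n) (fun w =>
    k w * Lambda 0 w.1.1 w.1.2 (Rho 0 w.2.1 w.2.2 f) z).

(* Twisted convolution on R^(2N) for N = 2n: the arguments (x, y) are here
   x = (x1, x2) and y = (y1, y2), so the order is ((x1, x2), (y1, y2)). *)
Definition twconv (f1 f2 : (V * V) * (V * V) -> R[i]) :
    (V * V) * (V * V) -> R[i] :=
  fun p => Cintegral (lebesgue_4n n) (fun q =>
    f1 q * f2 (p.1 - q.1, p.2 - q.2) *
    expi (pi * hbar * (dot2 q.1 p.2 - dot2 q.2 p.1))).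

End relative_convolution.

Section change_of_variables.
Context {R : realType} {n : nat}.

Local Notation V := 'rV[R]_n.

Variable upsilon : R.

(* From ((x1, x2), (y1, y2)) to the order ((x1, y1), (x2, y2)) of kernels. *)
Definition Bmap (p : (V * V) * (V * V)) : (V * V) * (V * V) :=
  ((p.1.1, p.2.1), (upsilon *: p.2.2, upsilon^-1 *: p.1.2)).

Definition Binv (w : (V * V) * (V * V)) : (V * V) * (V * V) :=
  ((w.1.1, upsilon *: w.2.2), (w.1.2, upsilon^-1 *: w.2.1)).

Lemma BmapK : upsilon != 0 -> cancel Bmap Binv.
Proof.
move=> u0 [[x1 x2] [y1 y2]].
by rewrite /Binv/= !scalerA mulfV// mulVf// !scale1r.
Qed.

Lemma BinvK : upsilon != 0 -> cancel Binv Bmap.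
Proof.
move=> u0 [[x1 y1] [x2 y2]].
by rewrite /Bmap/= !scalerA mulfV// mulVf// !scale1r.
Qed.

End change_of_variables.

(* Main.v *)
(* Lambda(0, x1, y1) Rho(0, x2, y2) acts on functions of z in R^(2n) as
   f |-> phi(w, .) f(t_w .), where w = ((x1, y1), (x2, y2)), t_w is a
   translation and phi is unimodular; these operators form a projective
   representation of the additive group R^(4n) with an explicit cocycle.
   Hence D(k1) D(k2) = D(k) for the convolution k of k1 and k2 twisted by this
   cocycle, by Fubini's theorem; the map B only rewrites the cocycle in the
   standard symplectic form, and it preserves Lebesgue measure.
   Fubini's theorem applies at almost every z because the absolute values,
   |k1| averaged against |k2| averaged against |f|, give again a
   square-integrable function of z, hence one that is finite almost
   everywhere. *)
Require Import Defs.
From HB Require Import structures.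
From mathcomp Require Import all_boot all_order all_algebra.
From mathcomp Require Import complex.
From mathcomp Require Import all_classical all_reals all_analysis.
From mathcomp Require Import measurable_realfun ring.

Set Implicit Arguments.
Unset Strict Implicit.
Unset Printing Implicit Defensive.

Import Order.TTheory GRing.Theory Num.Theory.
Import numFieldNormedType.Exports.

Local Open Scope classical_set_scope.
Local Open Scope ring_scope.
Local Open Scope complex_scope.

(** * Automated proofs of measurability *)

Lemma measurable_fun_comp2 d d1 d2 d3 (T : measurableType d)
    (T1 : measurableType d1) (T2 : measurableType d2) (T3 : measurableType d3)
    (h : T1 -> T2 -> T3) (a : T -> T1) (b : T -> T2) :
  measurable_fun setT (fun p : T1 * T2 => h p.1 p.2) ->
  measurable_fun setT a -> measurable_fun setT b ->
  measurable_fun setT (fun x => h (a x) (b x)).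
Proof.
by move=> mh ma mb; exact: (measurableT_comp mh (measurable_fun_pair ma mb)).
Qed.

Ltac measurability_step := cbv beta; match goal with
  | H : measurable_fun _ (fun p => ?h p.1 p.2) |-
      measurable_fun _ (fun x => ?h (@?a x) (@?b x)) =>
      refine (measurable_fun_comp2 H (_ : measurable_fun setT a)
        (_ : measurable_fun setT b))
  | H : measurable_fun _ ?h |- measurable_fun _ (fun x => ?h (@?g x)) =>
      refine (measurableT_comp H (_ : measurable_fun setT g))
  | |- measurable_fun _ (fun x => x) => exact: measurable_id
  | H : measurable_fun _ ?h |- measurable_fun _ ?h => exact H
  | |- measurable_fun _ (fun x => ?c) => exact: measurable_cst
  | |- measurable_fun _ (fun x => ((@?f x).1)) =>
      refine (measurableT_comp measurable_fst (_ : measurable_fun setT f))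
  | |- measurable_fun _ (fun x => ((@?f x).2)) =>
      refine (measurableT_comp measurable_snd (_ : measurable_fun setT f))
  | |- measurable_fun _ (fun x => ((@?f x), (@?g x))) =>
      refine (measurable_fun_pair (_ : measurable_fun setT f)
        (_ : measurable_fun setT g))
  | |- measurable_fun _ (fun x => (@?f x * @?g x)%E) =>
      refine (emeasurable_funM (_ : measurable_fun setT f)
        (_ : measurable_fun setT g))
  | |- measurable_fun _ (fun x => @GRing.add _ (@?f x) (@?g x)) =>
      refine (emeasurable_funD (_ : measurable_fun setT f)
        (_ : measurable_fun setT g))
  end.

Ltac measurability := intros; solve [repeat measurability_step].

(** * Maps that multiply integrals by a constant factor *)

Section scales_integral.
Context {d1 d2 : measure_display} {T1 : measurableType d1}
  {T2 : measurableType d2} {R : realType}.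
Local Open Scope ereal_scope.

(* For an invertible linear map [phi] of R^n, [c] is [1 / |det phi|]. *)
Definition scales_integral (mu : {measure set T1 -> \bar R})
    (nu : {measure set T2 -> \bar R}) (c : R) (phi : T1 -> T2) : Prop :=
  [/\ (0 <= c)%R, measurable_fun setT phi &
    forall f : T2 -> \bar R, measurable_fun setT f -> (forall y, 0 <= f y) ->
      \int[mu]_x f (phi x) = c%:E * \int[nu]_y f y].
End scales_integral.

Notation preserves_integral mu nu phi := (scales_integral mu nu 1 phi).

Section scales_integral_theory.
Local Open Scope ereal_scope.
Context {R : realType}.

(** An integral of [f] composed with [phi] is an integral of [f] against the pushforward measure,
    and an integral depends only on the values of the measure on measurable sets. *)
Lemma scales_integral_pushforward d1 d2 (T1 : measurableType d1)
    (T2 : measurableType d2) (mu : {measure set T1 -> \bar R})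
    (nu : {measure set T2 -> \bar R}) (c : {nonneg R}) (phi : T1 -> T2) :
  measurable_fun setT phi ->
  (forall A, measurable A -> pushforward mu phi A = mscale c nu A) ->
  scales_integral mu nu c%:num phi.
Proof.
move=> mphi E; split => // f mf f0.
have pf := ge0_integral_pushforward mphi mu measurableT mf (fun y _ => f0 y).
rewrite preimage_setT in pf; rewrite -[LHS]/(\int[mu]_x (f \o phi) x) -pf.
rewrite -ge0_integral_mscale//.
(* Bundling [phi] with its measurability lets the pushforward be recognised as a measure. *)
pose phi' : {mfun T1 >-> T2} :=
  HB.pack phi (isMeasurableFun.Build _ _ _ _ _ mphi).
apply: (@eq_measure_integral _ _ _ _ (mscale c nu)
  (pushforward mu phi' : {measure set T2 -> \bar R})) => A mA _; exact: E.
Qed.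

Lemma scales_integral_comp d1 d2 d3 (T1 : measurableType d1)
    (T2 : measurableType d2) (T3 : measurableType d3)
    (m1 : {measure set T1 -> \bar R}) (m2 : {measure set T2 -> \bar R})
    (m3 : {measure set T3 -> \bar R}) a b phi psi :
  scales_integral m1 m2 a phi -> scales_integral m2 m3 b psi ->
  scales_integral m1 m3 (a * b) (psi \o phi).
Proof.
move=> [a0 mphi Hphi] [b0 mpsi Hpsi]; split.
- exact: mulr_ge0.
- exact: measurableT_comp.
- move=> f mf f0.
  rewrite (Hphi _ (measurableT_comp mf mpsi) (fun y => f0 (psi y))).
  by rewrite Hpsi// EFinM muleA.
Qed.

End scales_integral_theory.

(** * Tonelli's theorem for [sf_product] and maps between product spaces *)

Section tonelli.
Context d1 d2 (T1 : measurableType d1) (T2 : measurableType d2) (R : realType).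
Variable m1 : {sigma_finite_measure set T1 -> \bar R}.
Variable m2 : {sigma_finite_measure set T2 -> \bar R}.
Local Open Scope ereal_scope.
Variable f : T1 * T2 -> \bar R.
Hypotheses (mf : measurable_fun setT f) (f0 : forall x, 0 <= f x).

Lemma sf_tonelli1 :
  \int[sf_product m1 m2]_z f z = \int[m1]_x \int[m2]_y f (x, y).
Proof. exact: (fubini_tonelli1 f). Qed.

Lemma sf_tonelli2 :
  \int[sf_product m1 m2]_z f z = \int[m2]_y \int[m1]_x f (x, y).
Proof. exact: (fubini_tonelli2 f). Qed.

Lemma measurable_tonelli1 : measurable_fun setT (fun x => \int[m2]_y f (x, y)).
Proof. exact: (measurable_fun_fubini_tonelli_F f). Qed.

Lemma measurable_tonelli2 : measurable_fun setT (fun y => \int[m1]_x f (x, y)).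
Proof. exact: (measurable_fun_fubini_tonelli_G f). Qed.

End tonelli.

Section scales_integral_product.
Local Open Scope ereal_scope.
Context {R : realType}.

(** Tonelli allows one substitution at a time: [b] leaves the inner integral and [a] the outer
    one. *)
Lemma scales_integral_pair d1 d2 d3 d4 (T1 : measurableType d1)
    (T2 : measurableType d2) (T3 : measurableType d3) (T4 : measurableType d4)
    (m1 : {sigma_finite_measure set T1 -> \bar R})
    (m2 : {sigma_finite_measure set T2 -> \bar R})
    (m3 : {sigma_finite_measure set T3 -> \bar R})
    (m4 : {sigma_finite_measure set T4 -> \bar R}) a b phi psi :
  scales_integral m1 m3 a phi -> scales_integral m2 m4 b psi ->
  scales_integral (sf_product m1 m2) (sf_product m3 m4) (a * b)
    (fun x => (phi x.1, psi x.2)).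
Proof.
move=> [a0 mphi Hphi] [b0 mpsi Hpsi].
have mpp : measurable_fun setT (fun x : T1 * T2 => (phi x.1, psi x.2)).
  by apply: measurable_fun_pair; [exact: (measurableT_comp mphi)|
    exact: (measurableT_comp mpsi)].
split; [exact: mulr_ge0|exact: mpp|move=> f mf f0].
rewrite sf_tonelli1//; last exact: (measurableT_comp mf mpp).
transitivity (\int[m1]_x (b%:E * \int[m4]_y f (phi x, y))).
  apply: eq_integral => x _; apply: (Hpsi (fun y => f (phi x, y))) => //.
  exact: measurableT_comp.
have mF : measurable_fun setT (fun x => \int[m4]_y f (x, y)).
  exact: measurable_tonelli1.
have F0 x : 0 <= \int[m4]_y f (x, y) by exact: integral_ge0.
rewrite ge0_integralZl//; last exact: (measurableT_comp mF mphi).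
rewrite (Hphi (fun x => \int[m4]_y f (x, y)))// -sf_tonelli1//.
by rewrite EFinM muleA (muleC a%:E).
Qed.

Lemma preserves_integral_swap d1 d2 (T1 : measurableType d1)
    (T2 : measurableType d2) (m1 : {sigma_finite_measure set T1 -> \bar R})
    (m2 : {sigma_finite_measure set T2 -> \bar R}) :
  preserves_integral (sf_product m1 m2) (sf_product m2 m1)
    (fun x => (x.2, x.1)).
Proof.
have ms : measurable_fun setT (fun x : T1 * T2 => (x.2, x.1)).
  exact: measurable_fun_pair.
split => // f mf f0.
rewrite sf_tonelli1//; last exact: (measurableT_comp mf ms).
by rewrite mul1e sf_tonelli2.
Qed.

(** This regrouping is the first stage of [Bmap]. Tonelli turns both sides into fourfold iterated
    integrals that differ only in the order of the two middle variables. *)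
Lemma preserves_integral_swap_inner d1 d2 d3 d4 (T1 : measurableType d1)
    (T2 : measurableType d2) (T3 : measurableType d3) (T4 : measurableType d4)
    (m1 : {sigma_finite_measure set T1 -> \bar R})
    (m2 : {sigma_finite_measure set T2 -> \bar R})
    (m3 : {sigma_finite_measure set T3 -> \bar R})
    (m4 : {sigma_finite_measure set T4 -> \bar R}) :
  preserves_integral
    (sf_product (sf_product m1 m2) (sf_product m3 m4))
    (sf_product (sf_product m1 m3) (sf_product m2 m4))
    (fun x => ((x.1.1, x.2.1), (x.1.2, x.2.2))).
Proof.
split => // [|f mf f0]; first by measurability.
rewrite mul1e.
have mg1 : measurable_fun setT (fun x : (T1 * T2) * (T3 * T4) =>
    f ((x.1.1, x.2.1), (x.1.2, x.2.2))) by measurability.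
have mg2 (x1 : T1) : measurable_fun setT (fun x : T2 * (T3 * T4) =>
    f ((x1, x.2.1), (x.1, x.2.2))) by measurability.
have mg3 (x1 : T1) : measurable_fun setT (fun x : (T2 * T3) * T4 =>
    f ((x1, x.1.2), (x.1.1, x.2))) by measurability.
have mg4 (x1 : T1) : measurable_fun setT (fun x : T3 * (T2 * T4) =>
    f ((x1, x.1), x.2)) by measurability.
rewrite sf_tonelli1// [RHS]sf_tonelli1//.
rewrite (sf_tonelli1 _ _ (measurable_tonelli1 _ mg1 _))//=.
rewrite [RHS](sf_tonelli1 _ _ (measurable_tonelli1 _ mf _))//=.
apply: eq_integral => x1 _.
transitivity (\int[m2]_x2 \int[m3]_x3 \int[m4]_x4 f ((x1, x3), (x2, x4))).
  by apply: eq_integral => x2 _; rewrite sf_tonelli1//; measurability.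
(* The only exchange of order; the innermost integral is carried along as a function of the two
   middle variables. *)
transitivity (\int[m3]_x3 \int[m2]_x2 \int[m4]_x4 f ((x1, x3), (x2, x4))).
  apply: (fubini_tonelli (fun p => \int[m4]_x4 f ((x1, p.2), (p.1, x4)))).
    exact: (measurable_tonelli1 _ (mg3 x1)).
  by move=> ?; exact: integral_ge0.
by apply: eq_integral => x3 _; rewrite sf_tonelli1//; measurability.
all: by move=> ?; exact: integral_ge0.
Qed.

End scales_integral_product.

(** * Change of variables for affine maps of R, R^n and R^(4n) *)

Section lebesgue_affine.
Context {R : realType}.

(** By uniqueness of Lebesgue measure, it is enough to compare it with $|a|$ times its pushforward
    on half-open intervals. *)
Lemma scales_integral_lebesgue_affine (a b : R) : a != 0 ->
  scales_integral (@lebesgue_measure R) (@lebesgue_measure R) `|a|^-1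
    (fun x : measurableTypeR R => a * x + b : measurableTypeR R).
Proof.
move=> a0.
have aN0 : 0 < `|a| by rewrite normr_gt0.
have mphi : measurable_fun setT
    (fun x : measurableTypeR R => a * x + b : measurableTypeR R).
  have : measurable_fun setT (fun x : R => a * x + b).
    by apply: measurable_funD => //; exact: measurable_funM.
  exact.
pose c : {nonneg R} := NngNum (ltW aN0).
pose phi' : {mfun measurableTypeR R >-> measurableTypeR R} :=
  HB.pack (fun x : measurableTypeR R => a * x + b : measurableTypeR R)
    (isMeasurableFun.Build _ _ _ _ _ mphi).
have E A : measurable A -> lebesgue_measure A =
    mscale c (pushforward (@lebesgue_measure R) phi') A.
  apply: lebesgue_measure_unique => _ [[x y] _ <-].
  (* The preimage of []x, y]]: for negative [a] the endpoints change places and the closed end moves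
     to the left. *)
  pose S : set (measurableTypeR R) :=
    if 0 < a then [set` `](x - b) / a, (y - b) / a]]
    else [set` `[(y - b) / a, (x - b) / a[].
  have preE : (fun x : R => a * x + b) @^-1` `]x, y] = S.
    rewrite /S.
    case: ifPn => [ap|]; last rewrite -leNgt le_eqVlt (negbTE a0)/= => an.
      apply/seteqP; split=> z /=; rewrite !in_itv/= ltr_pdivrMr// ler_pdivlMr//;
        by rewrite ltrBlDr lerBrDr mulrC.
    apply/seteqP; split=> z /=; rewrite !in_itv/= ler_ndivrMr// ltr_ndivlMr//;
      by rewrite lerBrDr ltrBlDr (mulrC z) andbC.
  transitivity (`|a|%:E * lebesgue_measure S)%E; last by rewrite -preE.
  rewrite lebesgue_measure_itv/= lte_fin /S.
  have [ap|an] := ltP 0 a; rewrite lebesgue_measure_itv/= lte_fin.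
    (* When the interval is empty, so is its preimage, and both measures are 0. *)
    rewrite ltr_pM2r ?invr_gt0// ltrD2r; case: ifPn => _; last by rewrite mule0.
    rewrite gtr0_norm// -!EFinB -EFinM; congr EFin.
    by rewrite -mulrBl mulrC mulfVK// opprD addrACA opprK addNr addr0.
  have {}an : a < 0 by rewrite lt_neqAle a0.
  rewrite ltr_nM2r ?invr_lt0// ltrD2r; case: ifPn => _; last by rewrite mule0.
  rewrite ltr0_norm// -!EFinB -EFinM; congr EFin.
  rewrite -mulrBl mulNr mulrC mulfVK// opprB opprD opprK addrACA addNr addr0.
  by rewrite addrC.
have c'0 : 0 <= `|a|^-1 by rewrite invr_ge0.
have := @scales_integral_pushforward R _ _ _ _ (@lebesgue_measure R)
  (@lebesgue_measure R) (NngNum c'0) _ mphi; apply => A mA.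
rewrite /mscale/= (E mphi _ mA) /mscale/= muleA -EFinM mulVf ?mul1e// gt_eqF//.
Qed.

Lemma preserves_integral_lebesgue_translate (b : R) :
  preserves_integral (@lebesgue_measure R) (@lebesgue_measure R)
    (fun x : measurableTypeR R => x + b : measurableTypeR R).
Proof.
have := @scales_integral_lebesgue_affine 1 b (oner_neq0 R).
by rewrite normr1 invr1; under eq_fun do rewrite mul1r.
Qed.

Lemma scales_integral_lebesgue_scale (a : R) : a != 0 ->
  scales_integral (@lebesgue_measure R) (@lebesgue_measure R) `|a|^-1
    (fun x : measurableTypeR R => a * x : measurableTypeR R).
Proof.
move/(@scales_integral_lebesgue_affine a 0).
by under eq_fun do rewrite addr0.
Qed.

End lebesgue_affine.

Section lebesgue_rV_affine.
Context {R : realType}.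

Lemma preserves_integral_rV_cons n
    (mu : {sigma_finite_measure set 'rV[R]_n -> \bar R}) :
  preserves_integral (sf_product lebesgue_measure mu) (lebesgue_rVS mu)
    (@rV_cons R n).
Proof.
have := @scales_integral_pushforward R _ _ _ _
  (sf_product lebesgue_measure mu) (lebesgue_rVS mu) 1%:nng (@rV_cons R n)
  measurable_rV_cons; apply => A mA.
by rewrite /mscale/= mul1e.
Qed.

(** The induction step on the dimension: [rV_cons] carries the product measure to [lebesgue_rVS mu]
    and conjugates [phi] to the pair of [phi1] and [phi2], so the factors multiply. *)
Lemma scales_integral_rVS n (mu : {sigma_finite_measure set 'rV[R]_n -> \bar R})
    (a b : R) (phi : 'rV[R]_n.+1 -> 'rV[R]_n.+1)
    (phi1 : measurableTypeR R -> measurableTypeR R)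
    (phi2 : 'rV[R]_n -> 'rV[R]_n) :
  measurable_fun setT phi ->
  (forall p, phi (rV_cons p) = rV_cons (phi1 p.1, phi2 p.2)) ->
  scales_integral lebesgue_measure lebesgue_measure a phi1 ->
  scales_integral mu mu b phi2 ->
  scales_integral (lebesgue_rVS mu) (lebesgue_rVS mu) (a * b) phi.
Proof.
move=> mphi phiE s1 s2.
have [ab0 _ H12] := scales_integral_pair s1 s2.
have [_ mc Hc] := preserves_integral_rV_cons mu.
split => // f mf f0.
have := Hc _ (measurableT_comp mf mphi) (fun y => f0 (phi y)).
rewrite mul1e => <-.
transitivity (\int[sf_product lebesgue_measure mu]_x
    (f \o @rV_cons R n) (phi1 x.1, phi2 x.2))%E.
  by apply: eq_integral => x _; rewrite /= phiE.
rewrite (H12 _ (measurableT_comp mf mc) (fun y => f0 (rV_cons y))).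
by rewrite -[in RHS](mul1e (integral _ _ _)) -(Hc f mf f0).
Qed.

Section measurable_operations.
Context {d : measure_display} {T : measurableType d} {n : nat}.
Implicit Types f g : T -> 'rV[R]_n.

Lemma measurable_rV_entry f i :
  measurable_fun setT f -> measurable_fun setT (fun x => f x ord0 i).
Proof. by move=> /measurable_fun_rVP. Qed.

Lemma measurable_rVD f g : measurable_fun setT f -> measurable_fun setT g ->
  measurable_fun setT (fun x => f x + g x).
Proof.
move=> mf mg; apply/measurable_fun_rVP => i.
under eq_fun do rewrite mxE.
by apply: measurable_funD; exact: measurable_rV_entry.
Qed.

Lemma measurable_rVZ (a : R) f : measurable_fun setT f ->
  measurable_fun setT (fun x => a *: f x).
Proof.
move=> mf; apply/measurable_fun_rVP => i.
under eq_fun do rewrite mxE.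
by apply: measurable_funM => //; exact: measurable_rV_entry.
Qed.

Lemma measurable_rVN f : measurable_fun setT f ->
  measurable_fun setT (fun x => - f x).
Proof.
by under [X in _ -> measurable_fun _ X]eq_fun do rewrite -scaleN1r;
  exact: measurable_rVZ.
Qed.

Lemma measurable_dot f g : measurable_fun setT f -> measurable_fun setT g ->
  measurable_fun setT (fun x => dot (f x) (g x)).
Proof.
move=> mf mg; rewrite /dot; apply: measurable_sum => i.
by apply: measurable_funM; exact: measurable_rV_entry.
Qed.

End measurable_operations.

Lemma rV_unconsK n : cancel (@rV_uncons R n) rV_cons.
Proof.
move=> v; rewrite /rV_cons /rV_uncons/=.
rewrite (_ : (v ord0 ord0)%:M = @lsubmx R 1 1 n v).
  exact: (@hsubmxK R 1 1 n v).
apply/matrixP => i j; rewrite !mxE !ord1 eqxx mulr1n.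
by congr (v _ _); exact/val_inj.
Qed.

Lemma rV_consD n x y (u v : 'rV[R]_n) :
  rV_cons (x + y : measurableTypeR R, u + v) = rV_cons (x, u) + rV_cons (y, v).
Proof.
by rewrite /rV_cons/= (@add_row_mx R 1 1 n) (raddfD (@scalar_mx R 1)).
Qed.

Lemma rV_consZ n a x (v : 'rV[R]_n) :
  rV_cons (a * x : measurableTypeR R, a *: v) = a *: rV_cons (x, v).
Proof.
by rewrite /rV_cons/= (@scale_row_mx R 1 1 n) scale_scalar_mx.
Qed.

Lemma preserves_integral_rV_translate n (v : 'rV[R]_n) :
  preserves_integral (lebesgue_rV n) (lebesgue_rV n) (fun x => x + v).
Proof.
elim: n v => [|n IH] v.
  have -> : (fun x : 'rV[R]_0 => x + v) = id.
    by apply/funext => x; rewrite [v]thinmx0 addr0.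
  by split => //= f mf f0; rewrite mul1e.
rewrite -[1]mulr1.
apply: (scales_integral_rVS _ _
  (preserves_integral_lebesgue_translate (v ord0 ord0)) (IH (rV_uncons v).2)).
  exact: measurable_rVD.
by move=> [x u]; rewrite -{1}[v]rV_unconsK -rV_consD.
Qed.

Lemma scales_integral_rV_scale n (a : R) : a != 0 ->
  scales_integral (lebesgue_rV n) (lebesgue_rV n) (`|a|^-1 ^+ n)
    (fun x : 'rV[R]_n => a *: x).
Proof.
move=> a0; elim: n => [|n IH].
  have -> : ( *:%R a : 'rV[R]_0 -> _) = id.
    by apply/funext => x; rewrite [x]thinmx0 scaler0.
  by split => //= f mf f0; rewrite mul1e.
rewrite exprS; apply: (scales_integral_rVS _ _
  (scales_integral_lebesgue_scale a0) IH) => [|[x u]].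
  exact: measurable_rVZ.
by rewrite -rV_consZ.
Qed.

End lebesgue_rV_affine.

Section lebesgue_4n.
Context {R : realType} {n : nat}.
Local Notation V := 'rV[R]_n.

Lemma preserves_integral_2n_translate (v : V * V) :
  preserves_integral (lebesgue_2n n) (lebesgue_2n n)
    (fun z => (z.1 + v.1, z.2 + v.2)).
Proof.
rewrite -[1]mulr1; exact: (scales_integral_pair
  (preserves_integral_rV_translate v.1) (preserves_integral_rV_translate v.2)).
Qed.

Lemma preserves_integral_4n_translate (v : (V * V) * (V * V)) :
  preserves_integral (lebesgue_4n n) (lebesgue_4n n)
    (fun w => ((w.1.1 + v.1.1, w.1.2 + v.1.2), (w.2.1 + v.2.1, w.2.2 + v.2.2))).
Proof.
rewrite -[1]mulr1; exact: (scales_integral_pair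
  (preserves_integral_2n_translate v.1) (preserves_integral_2n_translate v.2)).
Qed.

(* The Jacobian factors [|upsilon|^-n] and [|upsilon|^n] cancel. *)
Lemma preserves_integral_Bmap (upsilon : R) : upsilon != 0 ->
  preserves_integral (lebesgue_4n n) (lebesgue_4n n) (@Bmap R n upsilon).
Proof.
move=> u0.
have id2 : preserves_integral (@lebesgue_2n R n) (lebesgue_2n n) id.
  by split => // f mf f0; rewrite mul1e.
have scal := scales_integral_pair (scales_integral_rV_scale n u0)
  (scales_integral_rV_scale n (invr_neq0 u0)).
have swap2 := scales_integral_pair id2
  (preserves_integral_swap (@lebesgue_rV R n) (lebesgue_rV n)).
have inter := preserves_integral_swap_inner (@lebesgue_rV R n) (lebesgue_rV n)
  (lebesgue_rV n) (lebesgue_rV n).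
(* [Bmap] in three stages: regroup to [((x1, y1), (x2, y2))], swap the second pair to [(y2, x2)],
   then scale its entries by [upsilon] and its inverse. *)
have := scales_integral_comp inter
  (scales_integral_comp swap2 (scales_integral_pair id2 scal)).
rewrite !mul1r normfV -exprMn mulfV ?expr1n//.
by rewrite invr_eq0 normr_eq0.
Qed.

End lebesgue_4n.

(** * Modulus and measurability of complex-valued functions *)

Section complex_modulus.
Context {R : realType}.
Implicit Types z : R[i].

(** Extended-real values give access to the integration of nonnegative functions without prior
    finiteness. *)
Definition cabs z : \bar R := (Normc.normc z)%:E.

Lemma cabs_ge0 z : (0 <= cabs z)%E.
Proof. by rewrite lee_fin; case: z => a b; exact: sqrtr_ge0. Qed.

Lemma cabsM z1 z2 : cabs (z1 * z2) = (cabs z1 * cabs z2)%E.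
Proof. by rewrite /cabs Normc.normcM EFinM. Qed.

Lemma abs_Re_le_cabs z : (`|(complex.Re z)%:E| <= cabs z)%E.
Proof.
case: z => a b; rewrite lee_fin /= -sqrtr_sqr ler_wsqrtr//.
by rewrite lerDl sqr_ge0.
Qed.

Lemma abs_Im_le_cabs z : (`|(complex.Im z)%:E| <= cabs z)%E.
Proof.
case: z => a b; rewrite lee_fin /= -sqrtr_sqr ler_wsqrtr//.
by rewrite lerDr sqr_ge0.
Qed.

Lemma cabs_le_ReIm z :
  (cabs z <= `|(complex.Re z)%:E| + `|(complex.Im z)%:E|)%E.
Proof.
case: z => a b; rewrite -EFinD lee_fin /=.
rewrite -[leRHS]ger0_norm ?addr_ge0// -sqrtr_sqr ler_wsqrtr//.
by rewrite sqrrD !real_normK ?num_real// addrAC lerDl mulrn_wge0// mulr_ge0.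
Qed.

Lemma cabs_expi (t : R) : cabs (expi t) = 1%E.
Proof. by rewrite /cabs /= cos2Dsin2 sqrtr1. Qed.

Lemma expiD (s t : R) : expi (s + t) = expi s * expi t.
Proof.
rewrite /expi cosD sinD; apply/eqP; rewrite eq_complex /=.
by rewrite eqxx addrC (mulrC (cos s) (sin t)) (mulrC (sin t)) eqxx.
Qed.

End complex_modulus.

Section complex_measurable.
Context {d : measure_display} {T : measurableType d} {R : realType}.
Implicit Types f g : T -> R[i].

Definition Cmeasurable f : Prop :=
  measurable_fun setT (fun x => complex.Re (f x)) /\
  measurable_fun setT (fun x => complex.Im (f x)).

Lemma CmeasurableM f g :
  Cmeasurable f -> Cmeasurable g -> Cmeasurable (fun x => f x * g x).
Proof.
move=> [fr fi] [gr gi]; split.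
  rewrite (_ : (fun _ => _) = (fun x => complex.Re (f x) * complex.Re (g x) -
      complex.Im (f x) * complex.Im (g x))).
    by apply: measurable_funB; exact: measurable_funM.
  by apply/funext => x; case: (f x) (g x) => [a b] [c e].
rewrite (_ : (fun _ => _) = (fun x => complex.Re (f x) * complex.Im (g x) +
    complex.Im (f x) * complex.Re (g x))).
  by apply: measurable_funD; exact: measurable_funM.
by apply/funext => x; case: (f x) (g x) => [a b] [c e].
Qed.

Lemma Cmeasurable_expi (h : T -> R) :
  measurable_fun setT h -> Cmeasurable (fun x => expi (h x)).
Proof.
move=> mh; split=> /=.
  by apply: measurableT_comp mh; apply: continuous_measurable_fun => x;
    exact: continuous_cos.
by apply: measurableT_comp mh; apply: continuous_measurable_fun => x;
  exact: continuous_sin.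
Qed.

Lemma measurable_cabs f : Cmeasurable f -> measurable_fun setT (cabs \o f).
Proof.
move=> [fr fi]; apply/measurable_EFinP.
rewrite (_ : (fun _ => _) = Num.sqrt \o (fun x => complex.Re (f x) ^+ 2 +
    complex.Im (f x) ^+ 2)).
  apply: measurableT_comp.
    by apply: continuous_measurable_fun; exact: sqrt_continuous.
  by apply: measurable_funD; exact: measurable_funX.
by apply/funext => x /=; case: (f x).
Qed.

End complex_measurable.

Lemma Cmeasurable_comp d1 d2 (T1 : measurableType d1) (T2 : measurableType d2)
    (R : realType) (f : T2 -> R[i]) (phi : T1 -> T2) :
  Cmeasurable f -> measurable_fun setT phi -> Cmeasurable (fun x => f (phi x)).
Proof.
by move=> [fr fi] mphi; split; [exact: (measurableT_comp fr mphi)|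
  exact: (measurableT_comp fi mphi)].
Qed.

(** * Complex integrals: bounds, scalar factors, change of variables *)

Section complex_integral.
Context {d : measure_display} {T : measurableType d} {R : realType}.
Variable mu : {measure set T -> \bar R}.
Implicit Types f g : T -> R[i].
Local Open Scope ereal_scope.

Definition Cintegrable f : Prop :=
  Cmeasurable f /\ \int[mu]_x cabs (f x) < +oo.

Lemma Cintegrable_Re f : Cintegrable f ->
  mu.-integrable setT (fun x => (complex.Re (f x))%:E).
Proof.
move=> [[fr fi] foo]; apply/integrableP; split; first exact/measurable_EFinP.
apply: le_lt_trans foo; apply: ge0_le_integral => //.
- by apply: measurableT_comp => //; exact/measurable_EFinP.
- exact: (measurable_cabs (conj fr fi)).
- by move=> x _; exact: abs_Re_le_cabs.
Qed.

Lemma Cintegrable_Im f : Cintegrable f ->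
  mu.-integrable setT (fun x => (complex.Im (f x))%:E).
Proof.
move=> [[fr fi] foo]; apply/integrableP; split; first exact/measurable_EFinP.
apply: le_lt_trans foo; apply: ge0_le_integral => //.
- by apply: measurableT_comp => //; exact/measurable_EFinP.
- exact: (measurable_cabs (conj fr fi)).
- by move=> x _; exact: abs_Im_le_cabs.
Qed.

(** [fine] sends infinite values to 0, which can only decrease the absolute value. *)
Let abs_fine_le (x : \bar R) : `|(fine x)%:E| <= `|x|.
Proof. by case: x => [r| |] /=; rewrite ?normr0 ?leey. Qed.

(** Real and imaginary parts are each bounded by the integral of the modulus. The resulting factor 2
    is harmless, since the bound serves only to prove finiteness; it also holds when the right-hand
    side is infinite. *)
Lemma cabs_Cintegral_le f : Cmeasurable f ->
  cabs (Cintegral mu f) <= \int[mu]_x cabs (f x) + \int[mu]_x cabs (f x).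
Proof.
move=> [fr fi]; apply: (le_trans (cabs_le_ReIm _)); apply: leeD.
- apply: (le_trans (abs_fine_le _)).
  apply: (le_trans (le_abse_integral _ _ _)) => //.
    exact/measurable_EFinP.
  apply: ge0_le_integral => //.
  + by apply: measurableT_comp => //; exact/measurable_EFinP.
  + exact: (measurable_cabs (conj fr fi)).
  + by move=> x _; exact: abs_Re_le_cabs.
- apply: (le_trans (abs_fine_le _)).
  apply: (le_trans (le_abse_integral _ _ _)) => //.
    exact/measurable_EFinP.
  apply: ge0_le_integral => //.
  + by apply: measurableT_comp => //; exact/measurable_EFinP.
  + exact: (measurable_cabs (conj fr fi)).
  + by move=> x _; exact: abs_Im_le_cabs.
Qed.

Lemma CintegralZl f (c : R[i]) : Cintegrable f ->
  Cintegral mu (fun x => c * f x)%R = (c * Cintegral mu f)%R.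
Proof.
move=> fi; have ir := Cintegrable_Re fi; have ii := Cintegrable_Im fi.
case: c => a b; apply/eqP; rewrite eq_complex; apply/andP; split; apply/eqP.
- rewrite /= -!RintegralZl// -RintegralB//.
  + by apply: eq_Rintegral => x _; case: (f x).
  + exact: (integrableZl measurableT a ir).
  + exact: (integrableZl measurableT b ii).
- rewrite /= -!RintegralZl// -RintegralD//.
  + by apply: eq_Rintegral => x _; case: (f x).
  + exact: (integrableZl measurableT a ii).
  + exact: (integrableZl measurableT b ir).
Qed.

(** Fubini yields integrability of the product only. If [c] is 0 both sides vanish, whatever [f] is;
    otherwise dividing by [c] makes [f] integrable too. *)
Lemma CintegralZl_integrableM f (c : R[i]) : Cintegrable (fun x => c * f x)%R ->
  Cintegral mu (fun x => c * f x)%R = (c * Cintegral mu f)%R.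
Proof.
have [->|c0] := eqVneq c 0%R.
  move=> _; rewrite mul0r; under eq_fun do rewrite mul0r.
  by rewrite /Cintegral /Rintegral integral0.
move=> cf; have := CintegralZl c^-1%R cf.
under eq_fun do rewrite mulKf//.
by move=> ->; rewrite mulVKf.
Qed.

Lemma ae_eq_Cintegral f g : Cmeasurable f -> Cmeasurable g ->
  (\forall x \ae mu, f x = g x) -> Cintegral mu f = Cintegral mu g.
Proof.
move=> [fr fi] [gr gi] fg; congr (_ +i* _)%R; congr fine.
- apply: ae_eq_integral => //; [exact/measurable_EFinP|exact/measurable_EFinP|].
  by apply: filterS fg => x -> _.
- apply: ae_eq_integral => //; [exact/measurable_EFinP|exact/measurable_EFinP|].
  by apply: filterS fg => x -> _.
Qed.

End complex_integral.

Section complex_integral_transfer.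
Context d1 d2 (T1 : measurableType d1) (T2 : measurableType d2) (R : realType).
Local Open Scope ereal_scope.

(** Positive and negative parts are transported separately, so both sides are the same difference
    even when [f] is not integrable. *)
Lemma preserves_integral_signed (m1 : {measure set T1 -> \bar R})
    (m2 : {measure set T2 -> \bar R}) phi (f : T2 -> \bar R) :
  preserves_integral m1 m2 phi -> measurable_fun setT f ->
  \int[m1]_x f (phi x) = \int[m2]_y f y.
Proof.
move=> [_ mphi H] mf; rewrite integralE [RHS]integralE; congr (_ - _).
- have := H _ (measurable_funepos mf) (funepos_ge0 f); rewrite mul1e => <-.
  by apply: eq_integral => x _; rewrite !funeposE.
- have := H _ (measurable_funeneg mf) (funeneg_ge0 f); rewrite mul1e => <-.
  by apply: eq_integral => x _; rewrite !funenegE.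
Qed.

Lemma Cintegral_preserves (m1 : {measure set T1 -> \bar R})
    (m2 : {measure set T2 -> \bar R}) phi (f : T2 -> R[i]) :
  preserves_integral m1 m2 phi -> Cmeasurable f ->
  Cintegral m1 (fun x => f (phi x)) = Cintegral m2 f.
Proof.
move=> H [fr fi]; congr (_ +i* _)%R; congr fine.
- by apply: (preserves_integral_signed H); exact/measurable_EFinP.
- by apply: (preserves_integral_signed H); exact/measurable_EFinP.
Qed.

End complex_integral_transfer.

(** * Fubini's theorem for complex integrals *)

Section complex_fubini.
Context d1 d2 (T1 : measurableType d1) (T2 : measurableType d2) (R : realType).
Variable m1 : {sigma_finite_measure set T1 -> \bar R}.
Variable m2 : {sigma_finite_measure set T2 -> \bar R}.
Local Open Scope ereal_scope.

(** An integral is by definition the difference of those of the positive and negative parts, to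
    which Tonelli applies without integrability. *)
Let measurable_integral (h : T1 * T2 -> \bar R) : measurable_fun setT h ->
  measurable_fun setT (fun x => \int[m2]_y h (x, y)).
Proof.
move=> mh.
rewrite (_ : (fun _ => _) =
    (fun x => \int[m2]_y h^\+ (x, y)) \- (fun x => \int[m2]_y h^\- (x, y))).
  by apply: emeasurable_funB; apply: measurable_tonelli1;
    [exact: measurable_funepos|exact: funepos_ge0|
     exact: measurable_funeneg|exact: funeneg_ge0].
apply/funext => x; rewrite integralE.
by congr (_ - _); apply: eq_integral => y _; rewrite ?funeposE ?funenegE.
Qed.

Lemma Cmeasurable_Cintegral (f : T1 * T2 -> R[i]) : Cmeasurable f ->
  Cmeasurable (fun x => Cintegral m2 (fun y => f (x, y))).
Proof.
move=> [fr fi]; split => /=.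
- apply: measurableT_comp; first exact: fine_measurable.
  by apply: (measurable_integral (h := fun z => (complex.Re (f z))%:E));
    exact/measurable_EFinP.
- apply: measurableT_comp; first exact: fine_measurable.
  by apply: (measurable_integral (h := fun z => (complex.Im (f z))%:E));
    exact/measurable_EFinP.
Qed.

(** Almost every section is integrable, so the [fine] around the inner integrals changes nothing
    almost everywhere, and Fubini for extended reals applies. *)
Let Rintegral_fubini (h : T1 * T2 -> R) :
  (sf_product m1 m2).-integrable setT (EFin \o h) ->
  (\int[m1]_x \int[m2]_y h (x, y) = \int[m2]_y \int[m1]_x h (x, y))%R.
Proof.
move=> hi.
have mh := measurable_int _ hi.
rewrite /Rintegral; congr fine.
transitivity (\int[m1]_x \int[m2]_y (h (x, y))%:E).
  apply: ae_eq_integral => //.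
  - apply/measurable_EFinP; apply: measurableT_comp.
      exact: fine_measurable.
    exact: (measurable_integral mh).
  - exact: (measurable_integral mh).
  - have := ae_integrable1 hi; apply: filterS => x hx _.
    by rewrite fineK//; exact: integrable_fin_num.
transitivity (\int[m2]_y \int[m1]_x (h (x, y))%:E).
  exact: (Fubini hi).
apply/esym/ae_eq_integral => //.
- apply/measurable_EFinP; apply: measurableT_comp; first exact: fine_measurable.
  exact: (measurable_fubini_G hi).
- exact: (measurable_fubini_G hi).
- have := ae_integrable2 hi; apply: filterS => x hx _.
  by rewrite fineK//; exact: integrable_fin_num.
Qed.

Lemma Cintegral_fubini (f : T1 * T2 -> R[i]) :
  Cintegrable (sf_product m1 m2) f ->
  Cintegral m1 (fun x => Cintegral m2 (fun y => f (x, y))) =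
  Cintegral m2 (fun y => Cintegral m1 (fun x => f (x, y))).
Proof.
move=> fi; congr (_ +i* _)%R => /=.
- exact: (Rintegral_fubini (Cintegrable_Re fi)).
- exact: (Rintegral_fubini (Cintegrable_Im fi)).
Qed.

(** For almost every [x] the section of the product is integrable and [c x] can leave the inner
    integral. The function [g] alone may fail to be integrable, for instance where [c] vanishes. *)
Lemma Cintegral_factor (c : T1 -> R[i]) (g : T1 * T2 -> R[i]) :
  Cmeasurable c -> Cmeasurable g ->
  Cintegrable (sf_product m1 m2) (fun p => c p.1 * g p)%R ->
  Cintegral m1 (fun x => c x * Cintegral m2 (fun y => g (x, y)))%R =
  Cintegral m1 (fun x => Cintegral m2 (fun y => c x * g (x, y)))%R.
Proof.
move=> mc mg [mcg cgoo]; apply: ae_eq_Cintegral.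
- by apply: CmeasurableM => //; exact: Cmeasurable_Cintegral.
- exact: (Cmeasurable_Cintegral mcg).
- have mabs := measurable_cabs mcg.
  rewrite sf_tonelli1// in cgoo; last by move=> ?; exact: cabs_ge0.
  have mint : measurable_fun setT
      (fun x => \int[m2]_y cabs (c x * g (x, y))%R).
    by apply: (measurable_tonelli1 m2 mabs) => ?; exact: cabs_ge0.
  have int0 x : 0 <= \int[m2]_y cabs (c x * g (x, y))%R.
    by apply: integral_ge0 => y _; exact: cabs_ge0.
  have int : m1.-integrable setT (fun x => \int[m2]_y cabs (c x * g (x, y))%R).
    apply/integrableP; split => //.
    by under eq_integral do rewrite gee0_abs//.
  apply: filterS (integrable_ae measurableT int) => x /(_ I) xfin.
  apply/esym/CintegralZl_integrableM; split.
    exact: (Cmeasurable_comp mcg (pair1_measurable x)).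
  by rewrite ltey_eq xfin.
Qed.

End complex_fubini.

(** * Square-integrability of averages over a family of measure-preserving maps *)

Section averaging.
Context dW dZ (W : measurableType dW) (Z : measurableType dZ) (R : realType).
Variable mu : {sigma_finite_measure set W -> \bar R}.
Variable nu : {sigma_finite_measure set Z -> \bar R}.
Variable t : W -> Z -> Z.
Hypothesis mt : measurable_fun setT (fun p : W * Z => t p.1 p.2).
Hypothesis nut : forall w, preserves_integral nu nu (t w).
Local Open Scope ereal_scope.

(** The majorant of an integrated operator: absolute values remove the unimodular phase. It may take
    the value [+oo]. *)
Definition average (k : W -> \bar R) (g : Z -> \bar R) (z : Z) : \bar R :=
  \int[mu]_w (k w * g (t w z)).

Lemma average_ge0 k g z : (forall w, 0 <= k w) -> (forall z, 0 <= g z) ->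
  0 <= average k g z.
Proof. by move=> k0 g0; apply: integral_ge0 => w _; exact: mule_ge0. Qed.

Lemma measurable_average k g : (forall w, 0 <= k w) -> (forall z, 0 <= g z) ->
  measurable_fun setT k -> measurable_fun setT g ->
  measurable_fun setT (average k g).
Proof.
move=> k0 g0 mk mg.
apply: (measurable_tonelli2 mu (f := fun p => k p.1 * g (t p.1 p.2))).
- by measurability.
- by move=> p; exact: mule_ge0.
Qed.

(** Tonelli brings the integral over [z] inside, where invariance of [nu] removes [t w]. *)
Lemma integral_average k g : (forall w, 0 <= k w) -> (forall z, 0 <= g z) ->
  measurable_fun setT k -> measurable_fun setT g ->
  \int[nu]_z average k g z = \int[mu]_w k w * \int[nu]_z g z.
Proof.
move=> k0 g0 mk mg.
rewrite -(@fubini_tonelli _ _ _ _ _ mu nu (fun p => k p.1 * g (t p.1 p.2)));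
  [|by measurability|by move=> p; exact: mule_ge0].
rewrite -ge0_integralZr//; last exact: integral_ge0.
apply: eq_integral => w _ /=.
rewrite ge0_integralZl//; last by have [_ ? _] := nut w; measurability.
by have [_ _ ->] := nut w; rewrite ?mul1e.
Qed.

(** The product is at most the square of the larger factor, an argument that remains valid at
    [+oo]. *)
Let mule_le_sqrD (a b : \bar R) : 0 <= a -> 0 <= b -> a * b <= a * a + b * b.
Proof.
move=> a0 b0; have [ab|/ltW ba] := leP a b.
- by apply: (le_trans (lee_wpmul2r b0 ab)); rewrite leeDr// mule_ge0.
- by apply: (le_trans (lee_wpmul2l a0 ba)); rewrite leeDl// mule_ge0.
Qed.

(* Expanding the square as a double integral,
   [g g' <= g^2 + g'^2] replaces the Cauchy-Schwarz inequality, at the cost of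
   a factor 2. *)
Lemma average_sqr_le k g z : (forall w, 0 <= k w) -> (forall z, 0 <= g z) ->
  measurable_fun setT k -> measurable_fun setT g ->
  average k g z * average k g z <=
  \int[mu]_w k w * average k (fun z => g z * g z) z +
  \int[mu]_w k w * average k (fun z => g z * g z) z.
Proof.
move=> k0 g0 mk mg.
have mtz : measurable_fun setT (t ^~ z) by measurability.
pose q w := k w * (g (t w z) * g (t w z)).
have q0 w : 0 <= q w by rewrite !mule_ge0.
have mq : measurable_fun setT q by rewrite /q; measurability.
have h0 w : 0 <= k w * g (t w z) by rewrite mule_ge0.
have mh : measurable_fun setT (fun w => k w * g (t w z)) by measurability.
have K0 : 0 <= \int[mu]_w k w by exact: integral_ge0.
have A0 : 0 <= average k g z by exact: average_ge0.
have B0 : 0 <= \int[mu]_w q w by exact: integral_ge0.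
rewrite {1}/average -ge0_integralZr// {2 3}/average.
(* The same product is written as an integral over [w] in two ways, to match the terms
   $k(w)k(w')g(t_wz)^2$ and $k(w)k(w')g(t_{w'}z)^2$ of the bound below. *)
have -> : \int[mu]_w k w * \int[mu]_w q w + \int[mu]_w k w * \int[mu]_w q w =
    \int[mu]_w (q w * \int[mu]_w k w + k w * \int[mu]_w q w).
  by rewrite ge0_integralD ?ge0_integralZr//;
    [rewrite (muleC (\int[mu]_w q w))| | | |]; rewrite ?mule_ge0//;
    by [measurability|move=> *; exact: mule_ge0].
apply: ge0_le_integral => //; try by [measurability|move=> *; exact: mule_ge0].
move=> w _; rewrite /average -!ge0_integralZl// -ge0_integralD//;
  try by [measurability|move=> *; exact: mule_ge0].
apply: ge0_le_integral => //; try by [measurability|move=> *; exact: mule_ge0].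
move=> w' _; rewrite muleACA.
apply: (le_trans (lee_wpmul2l _ (mule_le_sqrD (g0 (t w z)) (g0 (t w' z))))).
  exact: mule_ge0.
rewrite ge0_muleDr ?mule_ge0// /q -!muleA; apply: leeD => //.
by rewrite (muleC (k w')) !muleA.
Qed.

(** A form of Young's inequality for L1 and L2: integrating [average_sqr_le] and applying
    [integral_average] to $g^2$ bounds the left side by $2(\int k)^2\int g^2$. *)
Lemma integral_average_sqr_le k g : (forall w, 0 <= k w) ->
  (forall z, 0 <= g z) -> measurable_fun setT k -> measurable_fun setT g ->
  \int[mu]_w k w < +oo -> \int[nu]_z (g z * g z) < +oo ->
  \int[nu]_z (average k g z * average k g z) < +oo.
Proof.
move=> k0 g0 mk mg koo goo.
have K0 : 0 <= \int[mu]_w k w by exact: integral_ge0.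
have gg0 z : 0 <= g z * g z by exact: mule_ge0.
have mgg : measurable_fun setT (fun z => g z * g z) by measurability.
have mA := measurable_average k0 g0 mk mg.
have mB := measurable_average k0 gg0 mk mgg.
have A0 z : 0 <= average k g z by exact: average_ge0.
have B0 z : 0 <= average k (fun z => g z * g z) z by exact: average_ge0.
apply: (@le_lt_trans _ _ (\int[nu]_z
  (\int[mu]_w k w * average k (fun z => g z * g z) z +
   \int[mu]_w k w * average k (fun z => g z * g z) z))).
  apply: ge0_le_integral => //;
    try by [measurability|move=> *; exact: mule_ge0].
  by move=> z _; exact: average_sqr_le.
rewrite ge0_integralD//;
  try by [measurability|move=> *; exact: mule_ge0].
rewrite ge0_integralZl// integral_average//.
by rewrite lte_add_pinfty// !lte_mul_pinfty// ?ge0_fin_numE// mule_ge0//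
  integral_ge0.
Qed.

End averaging.

(** * Measurability of complex expressions, and membership in L1 and L2 *)

Ltac Cmeasurability := intros; solve [repeat first [
  progress measurability_step | match goal with
  | H : Cmeasurable (fun p => ?h p.1 p.2) |-
      Cmeasurable (fun x => ?h (@?a x) (@?b x)) =>
      refine (Cmeasurable_comp H (measurable_fun_pair
        (_ : measurable_fun setT a) (_ : measurable_fun setT b)))
  | H : Cmeasurable ?h |- Cmeasurable (fun x => ?h (@?g x)) =>
      refine (Cmeasurable_comp H (_ : measurable_fun setT g))
  | H : Cmeasurable ?h |- Cmeasurable ?h => exact H
  | |- Cmeasurable (fun x => @GRing.mul _ (@?f x) (@?g x)) =>
      refine (CmeasurableM (_ : Cmeasurable f) (_ : Cmeasurable g))
  | |- measurable_fun _ (fun x => cabs (@?f x)) =>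
      refine (measurable_cabs (_ : Cmeasurable f))
  end]].

Section CLp.
Context d (T : measurableType d) (R : realType).
Variable mu : {measure set T -> \bar R}.
Implicit Types f : T -> R[i].
Local Open Scope ereal_scope.

Let abs_normc f x : `|(EFin \o (fun x => Normc.normc (f x))) x| = cabs (f x).
Proof. by rewrite gee0_abs// cabs_ge0. Qed.

Lemma CL1P f : CLp mu 1 f <-> Cintegrable mu f.
Proof.
rewrite /CLp /finite_norm Lnorm1 (eq_integral (fun x => cabs (f x))).
  by split=> [[? ? ?]|[[? ?] ?]].
by move=> x _; exact: abs_normc.
Qed.

(** The norm and the integral of the square are positive powers of each other, hence finite
    together. The square is written as a product to fit [integral_average_sqr_le]. *)
Lemma CL2P f : CLp mu 2%:E f <->
  Cmeasurable f /\ \int[mu]_x (cabs (f x) * cabs (f x)) < +oo.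
Proof.
have sqrE x : `|(EFin \o (fun x => Normc.normc (f x))) x| `^ 2 =
    cabs (f x) * cabs (f x).
  rewrite abs_normc /cabs poweR_EFin -EFinM -expr2 -powR_mulrn//.
  by have := cabs_ge0 (f x); rewrite lee_fin.
rewrite /CLp /finite_norm.
have -> : ('N[mu]_2%:E[EFin \o (fun x => Normc.normc (f x))] < +oo)%E =
    (\int[mu]_x (cabs (f x) * cabs (f x)) < +oo).
  rewrite -(eq_integral _ _ (fun x _ => sqrE x)).
  apply/idP/idP => [Noo|ioo].
    by rewrite -poweR_Lnorm// poweR_lty.
  by rewrite unlock poweR_lty.
by split=> [[? ? ?]|[[? ?] ?]].
Qed.

End CLp.

(* [w |-> (f |-> phi w z * f (t w z))] is a projective representation of the
   group [W], with cocycle [e]: the group law is [s], and [d (s w w') w = w']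
   makes [d p w] the quotient of [p] by [w]. *)
Section projective_representation.
Context dW dZ (W : measurableType dW) (Z : measurableType dZ) (R : realType).
Variable mu : {sigma_finite_measure set W -> \bar R}.
Variable nu : {sigma_finite_measure set Z -> \bar R}.
Variables (s d : W -> W -> W) (t : W -> Z -> Z).
Variables (phi : W -> Z -> R[i]) (e : W -> W -> R[i]).
Hypothesis md : measurable_fun setT (fun p : W * W => d p.1 p.2).
Hypothesis mt : measurable_fun setT (fun p : W * Z => t p.1 p.2).
Hypothesis mphi : Cmeasurable (fun p : W * Z => phi p.1 p.2).
Hypothesis me : Cmeasurable (fun p : W * W => e p.1 p.2).
Hypothesis mus : forall w, preserves_integral mu mu (s w).
Hypothesis nut : forall w, preserves_integral nu nu (t w).
Hypothesis sK : forall w w', d (s w w') w = w'.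
Hypothesis tD : forall w w' z, t (s w w') z = t w' (t w z).
Hypothesis cabs_phi : forall w z, cabs (phi w z) = 1%E.
Hypothesis cabs_e : forall w w', cabs (e w w') = 1%E.
Hypothesis cocycle : forall w w' z,
  e w (s w w') * phi (s w w') z = phi w z * phi w' (t w z).
Implicit Types (k : W -> R[i]) (f : Z -> R[i]).

Definition integrated_rep k f (z : Z) : R[i] :=
  Cintegral mu (fun w => k w * (phi w z * f (t w z))).

(** As in [cocycle], the second argument of [e] is the product [p], not the second factor
    [d p w]. *)
Definition twisted_conv k1 k2 (p : W) : R[i] :=
  Cintegral mu (fun w => k1 w * k2 (d p w) * e w p).

Lemma Cmeasurable_integrated_rep k f :
  Cmeasurable k -> Cmeasurable f -> Cmeasurable (integrated_rep k f).
Proof.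
move=> mk mf; apply: (Cmeasurable_Cintegral mu
  (f := fun p => k p.2 * (phi p.2 p.1 * f (t p.2 p.1)))).
by Cmeasurability.
Qed.

Lemma Cmeasurable_twisted_conv k1 k2 :
  Cmeasurable k1 -> Cmeasurable k2 -> Cmeasurable (twisted_conv k1 k2).
Proof.
move=> mk1 mk2; apply: (Cmeasurable_Cintegral mu
  (f := fun p => k1 p.2 * k2 (d p.1 p.2) * e p.2 p.1)).
by Cmeasurability.
Qed.

Local Open Scope ereal_scope.
Local Notation average := (average mu t).

Lemma cabs_integrated_rep_le k f z : Cmeasurable k -> Cmeasurable f ->
  cabs (integrated_rep k f z) <=
  average (cabs \o k) (cabs \o f) z + average (cabs \o k) (cabs \o f) z.
Proof.
move=> mk mf.
have avgE : average (cabs \o k) (cabs \o f) z =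
    \int[mu]_w cabs (k w * (phi w z * f (t w z)))%R.
  by apply: eq_integral => w _; rewrite !cabsM cabs_phi mul1e.
by rewrite avgE; apply: cabs_Cintegral_le; Cmeasurability.
Qed.

Lemma CL2_integrated_rep k f :
  CLp mu 1 k -> CLp nu 2%:E f -> CLp nu 2%:E (integrated_rep k f).
Proof.
move=> /CL1P[mk koo] /CL2P[mf foo]; apply/CL2P.
have mD := Cmeasurable_integrated_rep mk mf; split => //.
have k0 w : 0 <= (cabs \o k) w by exact: cabs_ge0.
have f0 z : 0 <= (cabs \o f) z by exact: cabs_ge0.
have mck := measurable_cabs mk; have mcf := measurable_cabs mf.
have mA := measurable_average mu mt k0 f0 mck mcf.
pose A := average (cabs \o k) (cabs \o f).
have A0 z : 0 <= A z by exact: average_ge0.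
have AAoo : \int[nu]_z (A z * A z) < +oo.
  exact: (integral_average_sqr_le mt nut k0 f0 mck mcf).
(* The constant 4 is the square of the factor 2 in [cabs_integrated_rep_le]. *)
apply: (@le_lt_trans _ _ (\int[nu]_z (4%:E * (A z * A z)))).
  apply: ge0_le_integral => //.
  - by move=> z _; rewrite mule_ge0// cabs_ge0.
  - by Cmeasurability.
  - by measurability.
  move=> z _; have cle := cabs_integrated_rep_le z mk mf.
  apply: (le_trans (lee_pmul _ _ cle cle)); rewrite ?cabs_ge0//.
  rewrite -/(A z) -mule2n -(mule_natl (A z) 2) muleACA -EFinM.
  by rewrite -natrM.
rewrite ge0_integralZl//; last by move=> *; exact: mule_ge0.
  by rewrite lte_mul_pinfty.
by measurability.
Qed.

(** The convolution [J] of the moduli dominates up to a factor 2, and Tonelli with invariance under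
    [s w] gives it the integral $\|k_1\|_1\|k_2\|_1$. *)
Lemma Cintegrable_twisted_conv k1 k2 :
  Cintegrable mu k1 -> Cintegrable mu k2 ->
  Cintegrable mu (twisted_conv k1 k2).
Proof.
move=> [mk1 k1oo] [mk2 k2oo].
have mk := Cmeasurable_twisted_conv mk1 mk2; split => //.
pose J p := \int[mu]_w (cabs (k1 w) * cabs (k2 (d p w))).
have J0 p : 0 <= J p by apply: integral_ge0 => w _; rewrite mule_ge0// cabs_ge0.
pose h (q : W * W) := cabs (k1 q.2) * cabs (k2 (d q.1 q.2)).
have h0 q : 0 <= h q by rewrite mule_ge0// cabs_ge0.
have mh : measurable_fun setT h by rewrite /h; Cmeasurability.
have mJ : measurable_fun setT J by exact: (measurable_tonelli1 mu mh h0).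
have JE : \int[mu]_p J p = \int[mu]_w cabs (k1 w) * \int[mu]_w cabs (k2 w).
  rewrite (fubini_tonelli h mh h0) -ge0_integralZr//; last 3 first.
  - by Cmeasurability.
  - by move=> w _; exact: cabs_ge0.
  - by apply: integral_ge0 => w _; exact: cabs_ge0.
  apply: eq_integral => w _.
  rewrite /h/= ge0_integralZl ?cabs_ge0//; last 2 first.
  - by Cmeasurability.
  - by move=> p _; exact: cabs_ge0.
  congr (_ * _).
  have [_ _ H] := mus w.
  (* Substituting [s w w'] for [p] turns [d p w] into [w']. *)
  have := H (fun p => cabs (k2 (d p w))) _ (fun p => cabs_ge0 _).
  rewrite mul1e => <-; last by Cmeasurability.
  by apply: eq_integral => p _; rewrite sK.
have Joo : \int[mu]_p J p < +oo.
  rewrite JE lte_mul_pinfty//.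
    by apply: integral_ge0 => w _; exact: cabs_ge0.
  by rewrite ge0_fin_numE//; apply: integral_ge0 => w _; exact: cabs_ge0.
apply: (@le_lt_trans _ _ (\int[mu]_p (J p + J p))); last first.
  by rewrite ge0_integralD// lte_add_pinfty.
apply: ge0_le_integral => //; try by [Cmeasurability|move=> *; exact: cabs_ge0].
move=> p _.
have -> : J p = \int[mu]_w cabs (k1 w * k2 (d p w) * e w p)%R.
  by apply: eq_integral => w _; rewrite !cabsM cabs_e mule1.
by apply: cabs_Cintegral_le; Cmeasurability.
Qed.

(** The composition is a double integral of [F] over [(w, w')]. Substituting [p] for [s w w'] turns
    [F] into [G] by the cocycle identity, and integrating [G] over [w] first produces the twisted
    convolution at [p]. *)
Lemma integrated_rep_comp_pointwise k1 k2 f z :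
  Cmeasurable k1 -> Cmeasurable k2 -> Cmeasurable f ->
  average (cabs \o k1) (average (cabs \o k2) (cabs \o f)) z < +oo ->
  integrated_rep k1 (integrated_rep k2 f) z =
  integrated_rep (twisted_conv k1 k2) f z.
Proof.
move=> mk1 mk2 mf zoo.
pose g q := (k2 q.2 * (phi q.2 (t q.1 z) * f (t q.2 (t q.1 z))))%R.
have mg : Cmeasurable g by rewrite /g; Cmeasurability.
pose F q := (k1 q.1 * phi q.1 z * g q)%R.
have mF : Cmeasurable F by rewrite /F; Cmeasurability.
pose E q := (k1 q.2 * k2 (d q.1 q.2) * e q.2 q.1)%R.
have mE : Cmeasurable E by rewrite /E; Cmeasurability.
pose G q := (phi q.1 z * f (t q.1 z) * E q)%R.
have mG : Cmeasurable G by rewrite /G; Cmeasurability.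
have GF w w' : G (s w w', w) = F (w, w').
  rewrite /G /F /E /g /= sK tD.
  transitivity (k1 w * k2 w' * (e w (s w w') * phi (s w w') z) *
    f (t w' (t w z)))%R; last rewrite cocycle; ring.
have FE : \int[mu]_w \int[mu]_w' cabs (F (w, w')) =
    average (cabs \o k1) (average (cabs \o k2) (cabs \o f)) z.
  apply: eq_integral => w _; rewrite /= /average -ge0_integralZl ?cabs_ge0//.
  - apply: eq_integral => w' _.
    by rewrite /F /g /= !cabsM !cabs_phi mule1 mul1e.
  - by rewrite /=; Cmeasurability.
  - by move=> w' _; rewrite mule_ge0// cabs_ge0.
have F0 q : 0 <= cabs (F q) by exact: cabs_ge0.
have G0 q : 0 <= cabs (G q) by exact: cabs_ge0.
have Fi : Cintegrable (sf_product mu mu) F.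
  by split => //; rewrite sf_tonelli1// ?FE//; exact: measurable_cabs.
(* Integrating over [p] first makes the substitution available, which reduces the claim to the
   finiteness known for [F]. *)
have Gi : Cintegrable (sf_product mu mu) G.
  split => //; rewrite sf_tonelli2//; last exact: measurable_cabs.
  rewrite (eq_integral (fun w => \int[mu]_w' cabs (F (w, w')))) ?FE// => w _.
  have [_ _ H] := mus w.
  have := H (fun p => cabs (G (p, w))) _ (fun p => cabs_ge0 _).
  rewrite mul1e => <-; last by Cmeasurability.
  by apply: eq_integral => w' _; rewrite GF.
transitivity (Cintegral mu (fun w => Cintegral mu (fun w' => F (w, w')))).
  (* The inner operator is multiplied by [k1 w * phi w z], and only the product with [g] is known to
     be integrable. *)
  rewrite -(@Cintegral_factor _ _ _ _ _ mu mu (fun w => k1 w * phi w z)%R g)//.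
    by congr Cintegral; apply/funext => w; rewrite /integrated_rep mulrA.
  by Cmeasurability.
transitivity (Cintegral mu (fun w => Cintegral mu (fun p => G (p, w)))).
  congr Cintegral; apply/funext => w.
  rewrite -(@Cintegral_preserves _ _ _ _ _ mu mu _ (fun p => G (p, w)) (mus w)).
    by congr Cintegral; apply/funext => w'; rewrite GF.
  by Cmeasurability.
rewrite -(Cintegral_fubini Gi).
(* What remains in the integral over [w] is [E], the integrand of [twisted_conv]. *)
rewrite -(@Cintegral_factor _ _ _ _ _ mu mu
  (fun p => phi p z * f (t p z))%R E)//.
  by congr Cintegral; apply/funext => p; rewrite /twisted_conv mulrC.
by Cmeasurability.
Qed.

Lemma integrated_rep_comp k1 k2 f :
  CLp mu 1 k1 -> CLp mu 1 k2 -> CLp nu 2%:E f ->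
  integrated_rep k1 (integrated_rep k2 f) =
  integrated_rep (twisted_conv k1 k2) f %[ae nu].
Proof.
move=> /CL1P[mk1 k1oo] /CL1P[mk2 k2oo] /CL2P[mf foo].
have k10 w : 0 <= (cabs \o k1) w by exact: cabs_ge0.
have k20 w : 0 <= (cabs \o k2) w by exact: cabs_ge0.
have f0 z : 0 <= (cabs \o f) z by exact: cabs_ge0.
have mck1 := measurable_cabs mk1; have mck2 := measurable_cabs mk2.
have mcf := measurable_cabs mf.
pose A := average (cabs \o k2) (cabs \o f).
have A0 z : 0 <= A z by exact: average_ge0.
have mA : measurable_fun setT A by exact: measurable_average.
have AAoo : \int[nu]_z (A z * A z) < +oo.
  exact: (integral_average_sqr_le mt nut k20 f0 mck2 mcf).
pose H := average (cabs \o k1) A.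
have H0 z : 0 <= H z by exact: average_ge0.
have mH : measurable_fun setT H by exact: measurable_average.
have HHoo : \int[nu]_z (H z * H z) < +oo.
  exact: (integral_average_sqr_le mt nut k10 A0 mck1 mA).
(* Finiteness almost everywhere is read off the square, as [H] is only known to be
   square-integrable. *)
have Hint : nu.-integrable setT (fun z => H z * H z).
  apply/integrableP; split; first by measurability.
  by under eq_integral do rewrite gee0_abs ?mule_ge0//.
apply: filterS (integrable_ae measurableT Hint) => z /(_ I) Hfin _.
apply: integrated_rep_comp_pointwise => //.
by move: Hfin; rewrite -/(H z); case: (H z) => [r|//|//] _; exact: ltry.
Qed.

End projective_representation.

(** * Dot products, and the two-sided action as a projective representation *)

Section dot_product.
Context {R : realType} {n : nat}.
Implicit Types x y z : 'rV[R]_n.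

Lemma dotC x y : dot x y = dot y x.
Proof. by apply: eq_bigr => i _; rewrite mulrC. Qed.

Lemma dotDr x y z : dot x (y + z) = dot x y + dot x z.
Proof. by rewrite -big_split; apply: eq_bigr => i _; rewrite mxE mulrDr. Qed.

Lemma dotZr a x y : dot x (a *: y) = a * dot x y.
Proof.
by rewrite /dot mulr_sumr; apply: eq_bigr => i _; rewrite mxE mulrCA.
Qed.

Lemma dotNr x y : dot x (- y) = - dot x y.
Proof. by rewrite -scaleN1r dotZr mulN1r. Qed.

Lemma dotDl x y z : dot (x + y) z = dot x z + dot y z.
Proof. by rewrite !(dotC _ z) dotDr. Qed.

Lemma dotZl a x y : dot (a *: x) y = a * dot x y.
Proof. by rewrite !(dotC _ y) dotZr. Qed.

End dot_product.

(** The same patterns for sums and opposites occur with vectors and with reals; an ill-typed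
    [refine] fails and the next rule is tried. *)
Ltac phase_measurability := intros; solve [repeat first [
  progress measurability_step | match goal with
  | |- Cmeasurable (fun x => expi (@?f x)) =>
      refine (Cmeasurable_expi (_ : measurable_fun setT f))
  | |- measurable_fun _ (fun x => dot (@?f x) (@?g x)) =>
      refine (measurable_dot (_ : measurable_fun setT f)
        (_ : measurable_fun setT g))
  | |- measurable_fun _ (fun x => @GRing.add _ (@?f x) (@?g x)) =>
      refine (measurable_rVD (_ : measurable_fun setT f)
        (_ : measurable_fun setT g))
  | |- measurable_fun _ (fun x => @GRing.opp _ (@?f x)) =>
      refine (measurable_rVN (_ : measurable_fun setT f))
  | |- measurable_fun _ (fun x => @GRing.add _ (@?f x) (@?g x)) =>
      refine (measurable_funD (_ : measurable_fun setT f)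
        (_ : measurable_fun setT g))
  | |- measurable_fun _ (fun x => @GRing.mul _ (@?f x) (@?g x)) =>
      refine (measurable_funM (_ : measurable_fun setT f)
        (_ : measurable_fun setT g))
  | |- measurable_fun _ (fun x => @GRing.opp _ (@?f x)) =>
      refine (measurableT_comp (@oppr_measurable _ setT)
        (_ : measurable_fun setT f))
  end]].

Section two_sided_representation.
Context {R : realType} {n : nat}.
Local Notation V := 'rV[R]_n.
Local Notation Z := (V * V)%type.
Local Notation W := ((V * V) * (V * V))%type.
Variable hbar : R.

(** With [w] on the right, [two_sided_add w] is by conversion the translation of
    [preserves_integral_4n_translate]. *)
Definition two_sided_add (w w' : W) : W :=
  ((w'.1.1 + w.1.1, w'.1.2 + w.1.2), (w'.2.1 + w.2.1, w'.2.2 + w.2.2)).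

Definition two_sided_sub (p w : W) : W :=
  ((p.1.1 - w.1.1, p.1.2 - w.1.2), (p.2.1 - w.2.1, p.2.2 - w.2.2)).

Definition two_sided_shift (w : W) (z : Z) : Z :=
  (z.1 - w.1.1 + w.2.1, z.2 - w.1.2 + w.2.2).

(** The phase of [Rho] is evaluated at the point already moved by [Lambda], whence the shifted
    arguments in its last two terms. *)
Definition two_sided_phase (w : W) (z : Z) : R[i] :=
  expi (pi * hbar * (dot w.1.1 z.2 - dot w.1.2 z.1 +
    dot w.2.1 (z.2 - w.1.2) - dot w.2.2 (z.1 - w.1.1))).

(** The symplectic form of the second block has the opposite sign; [Bmap] restores it by exchanging
    [x2] and [y2]. *)
Definition two_sided_cocycle (w p : W) : R[i] :=
  expi (pi * hbar * (dot w.1.1 p.1.2 - dot w.1.2 p.1.1 +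
    dot w.2.2 p.2.1 - dot w.2.1 p.2.2)).

Lemma measurable_two_sided_sub :
  measurable_fun setT (fun p : W * W => two_sided_sub p.1 p.2).
Proof. by rewrite /two_sided_sub; phase_measurability. Qed.

Lemma measurable_two_sided_shift :
  measurable_fun setT (fun p : W * Z => two_sided_shift p.1 p.2).
Proof. by rewrite /two_sided_shift; phase_measurability. Qed.

Lemma Cmeasurable_two_sided_phase :
  Cmeasurable (fun p : W * Z => two_sided_phase p.1 p.2).
Proof. by rewrite /two_sided_phase; phase_measurability. Qed.

Lemma Cmeasurable_two_sided_cocycle :
  Cmeasurable (fun p : W * W => two_sided_cocycle p.1 p.2).
Proof. by rewrite /two_sided_cocycle; phase_measurability. Qed.

Lemma preserves_integral_two_sided_shift w :
  preserves_integral (lebesgue_2n n) (lebesgue_2n n) (two_sided_shift w).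
Proof.
have := preserves_integral_2n_translate (w.2.1 - w.1.1, w.2.2 - w.1.2).
congr (scales_integral _ _ _ _); apply/funext => z.
by rewrite /two_sided_shift /=; congr pair; rewrite addrA addrAC.
Qed.

Lemma two_sided_addK w w' : two_sided_sub (two_sided_add w w') w = w'.
Proof.
by case: w' => [[x1 y1] [x2 y2]]; rewrite /two_sided_sub /= !addrK.
Qed.

Lemma two_sided_shiftD w w' z :
  two_sided_shift (two_sided_add w w') z =
  two_sided_shift w' (two_sided_shift w z).
Proof.
by rewrite /two_sided_shift /=; congr pair; apply/rowP => i; rewrite !mxE; ring.
Qed.

Lemma two_sided_cocycleP w w' z :
  two_sided_cocycle w (two_sided_add w w') *
    two_sided_phase (two_sided_add w w') z =
  two_sided_phase w z * two_sided_phase w' (two_sided_shift w z).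
Proof.
rewrite /two_sided_cocycle /two_sided_phase -!expiD; congr expi.
rewrite /two_sided_add /two_sided_shift /=.
(* Dot products are atoms for [ring], so symmetric ones are first brought to a common order. *)
rewrite !(dotDl, dotDr, dotNr) (dotC w.1.2 w.1.1) (dotC w.2.2 w.2.1).
rewrite !(dotC w'.1.1 w.1.2, dotC w'.1.1 w.2.2, dotC w'.1.2 w.1.1,
  dotC w'.1.2 w.2.1, dotC w'.2.1 w.1.2, dotC w'.2.1 w.2.2,
  dotC w'.2.2 w.1.1, dotC w'.2.2 w.2.1).
ring.
Qed.


End two_sided_representation.

(** * Transfer to relative convolutions and the composition theorem *)

Section relative_convolution_as_representation.
Context {R : realType} {n : nat}.
Local Notation V := 'rV[R]_n.
Local Notation W := ((V * V) * (V * V))%type.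
Variable hbar : R.

Lemma rconvE (k : W -> R[i]) (f : V * V -> R[i]) :
  rconv hbar k f = integrated_rep (lebesgue_4n n) two_sided_shift
    (two_sided_phase hbar) k f.
Proof.
apply/funext => z; congr Cintegral; apply/funext => w.
rewrite /Lambda /Rho /two_sided_phase /two_sided_shift /= !mulrA.
congr (_ * _); rewrite -mulrA -expiD; congr (_ * expi _); ring.
Qed.

(** The integration variable is replaced by [Bmap q]; in the phase [upsilon] meets its inverse. The
    change of variables needs measurability only, so equality holds at every point and not just
    almost everywhere. *)
Lemma twconv_BinvE (upsilon : R) (k1 k2 : W -> R[i]) : upsilon != 0 ->
  Cmeasurable k1 -> Cmeasurable k2 ->
  twconv hbar (k1 \o Bmap upsilon) (k2 \o Bmap upsilon) \o Binv upsilon =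
  twisted_conv (lebesgue_4n n) two_sided_sub (two_sided_cocycle hbar) k1 k2.
Proof.
move=> u0 mk1 mk2; apply/funext => p.
have md := @measurable_two_sided_sub R n.
have me := @Cmeasurable_two_sided_cocycle R n hbar.
rewrite /twisted_conv -(Cintegral_preserves (preserves_integral_Bmap u0)).
  congr Cintegral; apply/funext => q; rewrite /=; congr (_ * k2 _ * expi _).
    rewrite /Bmap /two_sided_sub /= !scalerBr !scalerA mulfV// mulVf//.
    by rewrite !scale1r.
  by rewrite /dot2 /Bmap /= !(dotZl, dotZr); ring.
by Cmeasurability.
Qed.

End relative_convolution_as_representation.

Theorem lemma6p10 (R : realType) (n : nat) (hbar upsilon : R)
    (hbar_neq0 : hbar != 0) (upsilon_neq0 : upsilon != 0)
    (k1 k2 : ('rV[R]_n * 'rV[R]_n) * ('rV[R]_n * 'rV[R]_n) -> R[i])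
    (k1L1 : CLp (lebesgue_4n n) 1%E k1) (k2L1 : CLp (lebesgue_4n n) 1%E k2) :
  let k := twconv hbar (k1 \o Bmap upsilon) (k2 \o Bmap upsilon)
             \o Binv upsilon in
  [/\ CLp (lebesgue_4n n) 1%E k,
      forall f : 'rV[R]_n * 'rV[R]_n -> R[i], CLp (lebesgue_2n n) 2%:E f ->
        CLp (lebesgue_2n n) 2%:E (rconv hbar k2 f) /\
        rconv hbar k1 (rconv hbar k2 f) = rconv hbar k f
          %[ae lebesgue_2n n] &
      forall x1' y1' x2' y2' : 'rV[R]_n,
        k ((x1', y1'), (x2', y2')) =
        Cintegral (lebesgue_4n n) (fun w =>
          let: ((x1, y1), (x2, y2)) := w in
          k1 ((x1, y1), (x2, y2)) *
          k2 ((x1' - x1, y1' - y1), (x2' - x2, y2' - y2)) *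
          expi (pi * hbar *
            (dot x1 y1' - dot y1 x1' + dot y2 x2' - dot x2 y2')))].
Proof.
move=> k.
have [mk1 _] := (CL1P _ _).1 k1L1; have [mk2 _] := (CL1P _ _).1 k2L1.
have kE : k = twisted_conv (lebesgue_4n n) two_sided_sub
    (two_sided_cocycle hbar) k1 k2 by exact: twconv_BinvE.
have md := @measurable_two_sided_sub R n.
have mt := @measurable_two_sided_shift R n.
have mphi := @Cmeasurable_two_sided_phase R n hbar.
have me := @Cmeasurable_two_sided_cocycle R n hbar.
have mus w : preserves_integral (lebesgue_4n n) (lebesgue_4n n)
    (@two_sided_add R n w) := preserves_integral_4n_translate w.
have nut := @preserves_integral_two_sided_shift R n.
split.
- apply/CL1P; rewrite kE.
  apply: (Cintegrable_twisted_conv md me mus (@two_sided_addK R n)).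
  + by move=> *; exact: cabs_expi.
  + exact/CL1P.
  + exact/CL1P.
- move=> f fL2; rewrite !rconvE kE; split.
    apply: (CL2_integrated_rep mt mphi nut) => //.
    by move=> *; exact: cabs_expi.
  apply: (integrated_rep_comp md mt mphi me mus nut (@two_sided_addK R n)
    (@two_sided_shiftD R n)) => //.
  + by move=> *; exact: cabs_expi.
  + exact: two_sided_cocycleP.
(* Once [k] is a [twisted_conv], the explicit formula is its definition with the integration
   variable destructured. *)
- move=> x1' y1' x2' y2'; rewrite kE; congr Cintegral.
  by apply/funext => -[[x1 y1] [x2 y2]].
Qed.
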